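(* Let $y\in\mathbb{C}$, and let $\ell:\mathbb{R}\to\mathbb{C}:\rho\mapsto y+\rho\theta$ be a line in $\mathbb{C}$ through $y$ with slope $\theta\in\mathbb{T}$. Let $\lambda_1,\dots,\lambda_p$ be the eigenvalues of $A$ that lie on $\ell$. Then the matrix $$A_+=A+\theta uu^*$$ is normal if and only if $u$ is a linear combination of eigenvectors of $A$ corresponding to $\lambda_1,\dots,\lambda_p$, with the convention that $u=0$ if $p=0$.
   Context: Here $A\in\mathbb{C}^{n\times n}$ is a normal matrix, $u\in\mathbb{C}^n$, $u^*$ is the conjugate transpose of $u$, and $\mathbb{T}=\{z\in\mathbb{C}:|z|=1\}$ is the circle group of unimodular complex numbers.
   Formalization: The line ℓ is not fixed in advance: only its slope θ is given, and A_+ is normal iff for some y the vector u is such a combination for the line through y; for a fixed y ''only if'' fails (n=1, A=(i), u=(1), θ=1, y=0). *)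

(* Defs.v *)
From mathcomp Require Import all_boot all_order all_algebra.
From mathcomp Require Import reals.
From mathcomp Require Export complex.

Set Implicit Arguments.
Unset Strict Implicit.
Unset Printing Implicit Defensive.

Import Order.TTheory GRing.Theory Num.Theory.

Local Open Scope ring_scope.
Local Open Scope complex_scope.

Definition line (R : realType) (y theta : R[i]) (rho : R) : R[i] :=
  y + rho%:C * theta.

(* Eigenvectors are columns, whereas [eigenvalue] and [eigenspace] in MathComp
   refer to the left action on rows.  The eigenvalues are the same on both
   sides, the eigenvectors are not. *)
Definition is_eigenvector (R : realType) (n : nat) (A : 'M[R[i]]_n)
    (lambda : R[i]) (v : 'cV[R[i]]_n) : Prop :=
  v != 0 /\ A *m v = lambda *: v.

(* [lambda] lists exactly the eigenvalues of [A] on the line; repetitions are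
   allowed, so that listing them with multiplicity is covered.  In the theorem
   only the slope [theta] is prescribed and [y] is existentially quantified.
   For a line fixed in advance, normality of the perturbed matrix does not
   imply that [u] is a combination of eigenvectors for the eigenvalues on that
   line: take [n = 1], [A = 'i%:M], [u = 1], [theta = 1], [y = 0].  The converse
   implication holds for every [y], and is contained in the existential form. *)
Definition lists_eigenvalues_on_line (R : realType) (n p : nat)
    (A : 'M[R[i]]_n) (y theta : R[i]) (lambda : 'I_p -> R[i]) : Prop :=
  forall z : R[i],
    (exists i, lambda i = z) <->
    eigenvalue A z /\ (exists rho : R, line y theta rho = z).

(* For [p = 0] only the empty sum [k = 0] is available, so that [u = 0]. *)
Definition is_eigenvector_combination (R : realType) (n p : nat)
    (A : 'M[R[i]]_n) (lambda : 'I_p -> R[i]) (u : 'cV[R[i]]_n) : Prop :=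
  exists (k : nat) (c : 'I_k -> R[i]) (v : 'I_k -> 'cV[R[i]]_n),
    (forall j, exists i, is_eigenvector A (lambda i) (v j)) /\
    u = \sum_(j < k) c j *: v j.

(* Main.v *)
(* Expanding the normality of [A + theta u u^*] and using that of [A], everything
   cancels except the commutation of [u u^*] with the skew-Hermitian matrix
   [K = conj(theta) A - theta A^*], which says that [u] is zero or an eigenvector
   of [K].  In an orthonormal eigenbasis of [A], [K] is diagonal with entries
   [conj(theta) d - theta conj(d)], and two eigenvalues [d] of [A] give the same
   entry exactly when they lie on a common line of slope [theta]. *)
Require Import Defs.
From mathcomp Require Import all_boot all_order all_algebra.
From mathcomp Require Import reals complex.

Set Implicit Arguments.
Unset Strict Implicit.
Unset Printing Implicit Defensive.

Import Order.TTheory GRing.Theory Num.Theory.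

Local Open Scope ring_scope.
Local Open Scope sesquilinear_scope.

Section NormalMatrices.
Variable C : numClosedFieldType.
Implicit Type t : C.

Lemma trmxC_mul m n p (A : 'M[C]_(m, n)) (B : 'M[C]_(n, p)) :
  (A *m B)^t* = B^t* *m A^t*.
Proof. by rewrite trmx_mul map_mxM. Qed.

Lemma trmxCD m n (A B : 'M[C]_(m, n)) : (A + B)^t* = A^t* + B^t*.
Proof. by rewrite linearD /= map_mxD. Qed.

Lemma trmxCN m n (A : 'M[C]_(m, n)) : (- A)^t* = - A^t*.
Proof. by rewrite linearN /= map_mxN. Qed.

Lemma trmxCZ m n a (A : 'M[C]_(m, n)) : (a *: A)^t* = a^* *: A^t*.
Proof. by rewrite linearZ /= map_mxZ. Qed.

Lemma mulmx_trmxC_eq0 n (u : 'cV[C]_n) : ((u^t* *m u) 0 0 == 0) = (u == 0).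
Proof.
apply/idP/eqP => [|->]; last by rewrite mulmx0 mxE.
rewrite mxE psumr_eq0 => [/allP u0|i _]; last first.
  by rewrite !mxE mulrC mul_conjC_ge0.
apply/colP => i; apply/eqP; have := u0 i (mem_index_enum _).
by rewrite !mxE mulrC mul_conjC_eq0.
Qed.

(** Twice the skew-Hermitian part of [t^* *: A]; for unimodular [t] this factor makes lines of slope
    [t] horizontal. *)
Definition rotated_skew_part t n (A : 'M[C]_n) : 'M[C]_n :=
  t^* *: A - t *: A^t*.

Lemma rotated_skew_part_trmxC t n (A : 'M[C]_n) :
  (rotated_skew_part t A)^t* = - rotated_skew_part t A.
Proof.
by rewrite /rotated_skew_part trmxCD trmxCN !trmxCZ trmxCK conjCK opprB addrC.
Qed.

Lemma normalmx_add_commute t n (A U : 'M[C]_n) :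
    A \is normalmx -> U^t* = U ->
  (A + t *: U) \is normalmx <->
  rotated_skew_part t A *m U = U *m rotated_skew_part t A.
Proof.
move=> /normalmxP AN UH; rewrite -(rwP normalmxP) /rotated_skew_part.
rewrite trmxCD trmxCZ UH !mulmxDl !mulmxDr -!scalemxAl -!scalemxAr !mulNmx.
rewrite !mulmxN -!scalemxAl -!scalemxAr AN !scalerA (mulrC t).
set a := _ *: (A *m U); set b := _ *: (A^t* *m U).
set c := _ *: (U *m A); set d := _ *: (U *m A^t*).
set e := A^t* *m A; set f := _ *: (U *m U).
(* Up to the order of the terms, normality reads [e + a + d + f = e + b + c + f] and commutation
   reads [a - b = c - d]. *)
rewrite 2!(rwP eqP) !addrA (inj_eq (addIr f)) -!addrA (inj_eq (addrI e)).
by rewrite subr_eq [c - d + b]addrAC [a == _]eq_sym subr_eq eq_sym [b + c]addrC.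
Qed.

(** Commutation of [K] with [u *m u^t*], applied to [u], makes [K *m u] a multiple of [u].
    Conversely, skewness of [K] makes [u^t*] a left eigenvector for the same [mu]. *)
Lemma normalmx_add_rank1 t n (A : 'M[C]_n) (u : 'cV[C]_n) :
    A \is normalmx ->
  (A + t *: (u *m u^t*)) \is normalmx <->
  exists mu, rotated_skew_part t A *m u = mu *: u.
Proof.
move=> AN; have UH : (u *m u^t*)^t* = u *m u^t* by rewrite trmxC_mul trmxCK.
rewrite (normalmx_add_commute t AN UH); set K := rotated_skew_part t A.
have [->|u_neq0] := eqVneq u 0.
  by rewrite !mul0mx mulmx0; split=> // _; exists 0; rewrite mulmx0 scaler0.
set s := (u^t* *m u) 0 0; have s_neq0 : s != 0 by rewrite mulmx_trmxC_eq0.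
have uu : u^t* *m u = s%:M by rewrite [LHS]mx11_scalar.
split=> [/(congr1 (mulmx^~ u))|[mu Ku]].
  rewrite -!mulmxA uu [u^t* *m (K *m u)]mx11_scalar !mul_mx_scalar -scalemxAr.
  set r := (_ 0 0) => E; exists (s^-1 * r).
  by rewrite -scalerA -E scalerA mulVf ?scale1r.
have uK : u^t* *m K = - mu^* *: u^t*.
  have := congr1 (fun X => X^t*) Ku; rewrite trmxC_mul trmxCZ.
  by rewrite rotated_skew_part_trmxC mulmxN scaleNr => <-; rewrite opprK.
(* [mu] is purely imaginary: evaluate [u^t* *m K *m u] from both sides. *)
have muN : mu = - mu^*.
  have := congr1 (mulmx (u^t*)) Ku; rewrite mulmxA uK -scalemxAl -scalemxAr uu.
  by move/matrixP/(_ 0 0); rewrite !mxE eqxx !mulr1n => /(mulIf s_neq0).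
by rewrite mulmxA Ku -mulmxA uK -scalemxAl -scalemxAr -muN.
Qed.

(** The squared norm of [A^t* *m v - lambda^* *: v] vanishes once normality replaces [A *m A^t*] by
    [A^t* *m A]. *)
Lemma normalmx_eigenvector_trmxC n (A : 'M[C]_n) lambda (v : 'cV[C]_n) :
  A \is normalmx -> A *m v = lambda *: v -> A^t* *m v = lambda^* *: v.
Proof.
move=> /normalmxP AN Av; apply/eqP; rewrite -subr_eq0 -mulmx_trmxC_eq0.
have vA : v^t* *m A^t* = lambda^* *: v^t* by rewrite -trmxC_mul Av trmxCZ.
rewrite trmxCD trmxCN trmxCZ trmxC_mul trmxCK conjCK mulmxBr.
rewrite -[X in _ - X]scalemxAr !mulmxBl -!mulmxA Av -!scalemxAl -scalemxAr.
rewrite subrr scaler0 subr0 (mulmxA A) AN -mulmxA Av -!scalemxAr !mulmxA vA.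
by rewrite -!scalemxAl !scalerA subrr mxE.
Qed.

Lemma rotated_skew_part_eigenvector t n (A : 'M[C]_n) lambda (v : 'cV[C]_n) :
    A \is normalmx -> A *m v = lambda *: v ->
  rotated_skew_part t A *m v = (t^* * lambda - t * lambda^*) *: v.
Proof.
move=> AN Av; rewrite mulmxBl -!scalemxAl Av.
by rewrite (normalmx_eigenvector_trmxC AN Av) !scalerA scalerBl.
Qed.

(** The spectral theorem gives [A = invmx P *m diag_mx _ *m P] with [P] unitary, so column
    eigenvectors are read off [invmx P = P^t*]. *)
Lemma normalmx_eigenbasis n (A : 'M[C]_n) : A \is normalmx ->
  exists (P : 'M[C]_n) (d : 'I_n -> C), P^t* *m P = 1%:M /\
    forall j, A *m col j (P^t*) = d j *: col j (P^t*).
Proof.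
move=> /orthomx_spectralP AE; set P := spectralmx A in AE.
have PU : P \is unitarymx := spectral_unitarymx A.
exists P, (spectral_diag A 0); rewrite -invmx_unitary //; split=> [|j].
  by rewrite mulVmx ?unitarymx_unit.
rewrite !colE mulmxA {1}AE mulmxK ?unitarymx_unit // -!colE.
by apply/colP => i; rewrite mxE mul_mx_diag !mxE mulrC.
Qed.

(** A nonzero column killed by [A - lambda%:M] makes this matrix singular, which also yields a row
    eigenvector. *)
Lemma eigenvalue_cV n (A : 'M[C]_n) lambda (v : 'cV[C]_n) :
  v != 0 -> A *m v = lambda *: v -> eigenvalue A lambda.
Proof.
move=> v_neq0 Av; rewrite /eigenvalue /eigenspace kermx_eq0 row_free_unit.
apply: contra v_neq0 => Aunit; apply/eqP; rewrite -[v](mulKmx Aunit).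
by rewrite mulmxBl Av mul_scalar_mx subrr mulmx0.
Qed.

Lemma eigenvalue_seq n (A : 'M[C]_n) : {s : seq C | eigenvalue A =i s}.
Proof.
have [s sE] := closed_field_poly_normal (char_poly A); exists s => z.
rewrite -topredE /= eigenvalue_root_char sE (monicP (char_poly_monic A)).
by rewrite scale1r root_prod_XsubC.
Qed.

End NormalMatrices.

Local Open Scope complex_scope.

Section Lines.
Variable R : realType.

(** Each side is [2i] times the imaginary part of [theta^* z], respectively [theta^* y]. Equality
    says that [theta^* (z - y)] is real, and this real number is [rho]. *)
Lemma lineP (y theta z : R[i]) : `|theta| = 1 ->
  (exists rho, line y theta rho = z) <->
  theta^*%R * z - theta * z^*%R = theta^*%R * y - theta * y^*%R.
Proof.
move=> theta1; have tt : theta * theta^*%R = 1 by rewrite -normCK theta1 expr1n.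
have realC (r : R) : Num.conj r%:C = r%:C :> R[i].
  by apply/CrealP/complex_realP; exists r.
split=> [[rho <-]|E].
  rewrite /line rmorphD rmorphM /= realC !mulrDr opprD.
  by rewrite ![_ * (rho%:C * _)]mulrCA tt (mulrC _ theta) tt addrACA subrr addr0.
have /complex_realP[r rE] : theta^*%R * (z - y) \is Num.real.
  apply/CrealP; rewrite rmorphM rmorphB /= conjCK !mulrBr.
  move: E; set a := theta^*%R * z; set b := theta * z^*%R.
  set c := theta^*%R * y; set d := theta * y^*%R => E.
  by rewrite -(subrK b a) E addrAC [c - d - c]addrAC subrr sub0r addrC.
by exists r; rewrite /line -rE mulrAC (mulrC _ theta) tt mul1r addrC subrK.
Qed.

Lemma exists_eigenvalues_on_line n (A : 'M[R[i]]_n) (y theta : R[i]) :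
    `|theta| = 1 ->
  exists (p : nat) (lambda : 'I_p -> R[i]),
    lists_eigenvalues_on_line A y theta lambda.
Proof.
move=> theta1; have [s sE] := eigenvalue_seq A.
(* By [lineP], lying on the line is a decidable equation, by which the list of eigenvalues can be
   filtered. *)
pose on_line z := theta^*%R * z - theta * z^*%R == theta^*%R * y - theta * y^*%R.
pose r := filter on_line s.
exists (size r), (tnth (in_tuple r)) => z; rewrite (lineP y z theta1).
rewrite (_ : eigenvalue A z = (z \in s)); last by rewrite -sE.
split=> [[i <-]|[zs /eqP zy]].
  by have := mem_tnth i (in_tuple r); rewrite mem_filter => /andP[/eqP].
have /tnthP[i ->] : z \in in_tuple r by rewrite mem_filter zs andbT.
by exists i.
Qed.

End Lines.

Theorem theorem4p5 (R : realType) (n : nat) (A : 'M[R[i]]_n)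
    (u : 'cV[R[i]]_n) (theta : R[i])
    (A_normal : A \is normalmx) (theta_unimodular : `|theta| = 1) :
  (A + theta *: (u *m u ^t*)) \is normalmx <->
  exists (y : R[i]) (p : nat) (lambda : 'I_p -> R[i]),
    lists_eigenvalues_on_line A y theta lambda /\
    is_eigenvector_combination A lambda u.
Proof.
rewrite (normalmx_add_rank1 theta u A_normal); split; last first.
  move=> [y [p [lambda [on_line [k [c [v [eig ->]]]]]]]].
  (* The eigenvalue of [K] shared, by [lineP], by all [v j]. *)
  exists (theta^*%R * y - theta * y^*%R).
  rewrite mulmx_sumr scaler_sumr; apply: eq_bigr => j _.
  have [i [_ Av]] := eig j.
  have [_ line_i] := (on_line (lambda i)).1 (ex_intro _ i erefl).
  rewrite -scalemxAr (rotated_skew_part_eigenvector theta A_normal Av).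
  by rewrite ((lineP _ _ theta_unimodular).1 line_i) scalerA mulrC -scalerA.
move=> [mu Ku]; have [P [d [PP AP]]] := normalmx_eigenbasis A_normal.
(* [w] holds the coordinates of [u] in the eigenbasis, and [S] is their support. *)
have [w wE] : {w | w = P *m u} by exists (P *m u).
pose S := [set j | w j 0 != 0].
have PPt : P *m P^t* = 1%:M by apply: mulmx1C.
have uE : u = \sum_j w j 0 *: col j (P^t*).
  rewrite -[LHS]mul1mx -PP -mulmxA -wE; apply/colP => i.
  by rewrite summxE mxE; apply: eq_bigr => j _; rewrite !mxE mulrC.
have col_neq0 j : col j (P^t*) != 0.
  apply/eqP => c0; have := congr1 (mulmx P) c0; rewrite mulmx0 colE mulmxA PPt mul1mx.
  by move=> /colP/(_ j)/eqP; rewrite !mxE eqxx oner_eq0.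
have muE j : j \in S -> theta^*%R * d j - theta * (d j)^*%R = mu.
  rewrite inE => wj.
  (* Compare the coordinates at [j] in [K *m u = mu *: u] and cancel [w j 0]. *)
  have := congr1 (mulmx P) Ku; rewrite {1}uE mulmx_sumr.
  under eq_bigr do rewrite -scalemxAr
    (rotated_skew_part_eigenvector theta A_normal (AP _)).
  rewrite mulmx_sumr -scalemxAr -wE => /colP/(_ j).
  rewrite summxE (bigD1 j) //= big1 => [|i ij].
    rewrite -!scalemxAr colE mulmxA PPt mul1mx !mxE eqxx mulr1 addr0 mulrC.
    by move=> /(mulIf wj).
  by rewrite -!scalemxAr colE mulmxA PPt mul1mx !mxE eq_sym (negPf ij) !mulr0.
have [y yE] : exists y,
    forall j, j \in S -> exists rho, line y theta rho = d j.
  (* If [S] is empty, then [u = 0] and any [y] serves; otherwise any [d j0] with [j0] in [S] does,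
     since all of them give the value [mu]. *)
  have [S0|[j0 j0S]] := set_0Vmem S; first by exists 0 => j; rewrite S0 inE.
  exists (d j0) => j jS; apply/(lineP _ _ theta_unimodular).
  by rewrite !muE.
have [p [lambda on_line]] := exists_eigenvalues_on_line A y theta_unimodular.
exists y, p, lambda; split=> //.
(* The sum is restricted to [S]: outside it [d j] may lie off the line, but the coefficient is
   zero. *)
exists #|S|, (fun k => w (enum_val k) 0), (fun k => col (enum_val k) (P^t*)).
split=> [k|].
  have [i lambda_i] : exists i, lambda i = d (enum_val k).
    apply/on_line; split; last exact/yE/enum_valP.
    exact: eigenvalue_cV (col_neq0 _) (AP _).
  by exists i; rewrite lambda_i.
rewrite -(big_enum_val (fun j => w j 0 *: col j (P^t*))).
rewrite {1}uE [LHS](bigID (mem S)) /= [X in _ + X]big1 ?addr0 // => j.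
by rewrite inE negbK => /eqP->; rewrite scale0r.
Qed.
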